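(* For every real $p\ge1$ we have \[ \nu(p,-1)=\frac1p\,\delta_0+\frac{p-1}{p}\,\nu(p,0) \] and \[ d\nu(p,p-1)(x)=\frac{x}{p}\,d\nu(p,0)(x). \]
   Context: For $a\in\mathbb{R}$ and $n\in\{0,1,2,\ldots\}$, $\binom{a}{n}:=a(a-1)\cdots(a-n+1)/n!$ (with $\binom a0=1$). For $p\ge1$, $-1\le r\le p-1$, $\nu(p,r)$ denotes the unique probability measure with moments $\int x^n\,d\nu(p,r)(x)=\binom{np+r}{n}$, $n=0,1,2,\ldots$; its support is contained in $[0,c(p)]$, $c(p)=p^p(p-1)^{1-p}$ (with $c(1)=1$). $\delta_0$ is the unit point mass at $0$. *)

(* Defs.v *)
From HB Require Import structures.
From mathcomp Require Import all_boot all_order all_algebra.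
From mathcomp Require Import all_classical all_reals all_analysis.
Import Order.TTheory GRing.Theory Num.Theory numFieldNormedType.Exports.

Set Implicit Arguments.
Unset Strict Implicit.
Unset Printing Implicit Defensive.

Local Open Scope classical_set_scope.
Local Open Scope ring_scope.

Definition gbinom (R : realType) (a : R) (n : nat) : R :=
  (\prod_(i < n) (a - i%:R)) / n`!%:R.

(* [is_nu p r mu] reads "mu = nu(p,r)". The measure nu(p,r) is determined among
   all Borel probability measures on the line by its moments alone, so neither
   uniqueness nor the support condition is part of the definition. *)
Definition is_nu (R : realType) (p r : R)
    (mu : probability (measurableTypeR R) R) : Prop :=
  forall n : nat,
    mu.-integrable setT (fun x : measurableTypeR R => ((x : R) ^+ n)%:E) /\
    (\int[mu]_x ((x : R) ^+ n)%:E = (gbinom (n%:R * p + r) n)%:E)%E.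

(* Main.v *)
(** The relations binom(np-1,n) = (p-1)/p binom(np,n) for n >= 1 and
    binom(np+p-1,n) = binom((n+1)p,n+1)/p are the two claims at the level of
    moments. The moments of all three measures are at most C^n with
    C = 2pe, so the measures live on [-2C,2C]. There, polynomials bounded by 1
    converge pointwise to the indicator of any ray ]-oo,a[, so dominated
    convergence shows that the moments determine the mass of every ray, also
    for nu(p,0) weighted by x/p, which is not yet known to be nonnegative.
    Its mass on ]-oo,0[ is nonpositive and equals nu(p,p-1)(]-oo,0[) >= 0, so
    nu(p,0) does not charge ]-oo,0[ and x/p is a.e. the density of a genuine
    measure; measures agreeing on rays are equal. *)
From HB Require Import structures.
Require Import Defs.
From mathcomp Require Import all_boot all_order all_algebra.
From mathcomp Require Import all_classical all_reals all_analysis.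
From mathcomp Require Import measurable_realfun ring lra.
Import Order.TTheory GRing.Theory Num.Theory numFieldNormedType.Exports.

Local Open Scope classical_set_scope.
Local Open Scope ring_scope.

(** * Generalised binomial coefficients: identities and growth *)

Lemma gbinomS (R : realType) (a : R) (n : nat) :
  gbinom a n.+1 = a / n.+1%:R * gbinom (a - 1) n.
Proof.
rewrite /gbinom big_ord_recl subr0 factS natrM invfM.
rewrite (eq_bigr (fun i : 'I_n => a - 1 - i%:R)); first by ring.
by move=> i _; rewrite lift0 -natr1; ring.
Qed.

Lemma gbinomSr (R : realType) (a : R) (n : nat) :
  gbinom a n.+1 = gbinom a n * ((a - n%:R) / n.+1%:R).
Proof. by rewrite /gbinom big_ord_recr factS mulnC natrM invfM/= mulrACA. Qed.

Lemma gbinom0 (R : realType) (a : R) : gbinom a 0 = 1.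
Proof. by rewrite /gbinom big_ord0 fact0 divr1. Qed.

(* [0 ^+ n] (with [0 ^+ 0 = 1]) is the [n]-th moment of the unit mass at [0]. *)
Lemma gbinom_predE (R : realType) (p : R) (n : nat) : 1 <= p ->
  gbinom (n%:R * p - 1) n =
    1 / p * 0 ^+ n + (p - 1) / p * gbinom (n%:R * p + 0) n.
Proof.
move=> p1; have p0 : p != 0 by rewrite gt_eqF// (lt_le_trans ltr01).
case: n => [|n]; first by rewrite !gbinom0 expr0; field.
rewrite addr0 exprS mul0r mulr0 add0r.
have n0 : n.+1%:R != 0 :> R by rewrite pnatr_eq0.
have n1 : n.+2%:R != 0 :> R by rewrite pnatr_eq0.
(* With a = n+1, splitting off the first or the last factor of binom(ap, a+1) gives ap binom(ap-1,
   a) = (ap-a) binom(ap, a). *)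
have := gbinomS R (n.+1%:R * p) n.+1; rewrite gbinomSr.
move: (gbinom _ n.+1) (gbinom _ n.+1) n0 n1.
move: (n.+1%:R : R) (n.+2%:R : R) => a b v u a0 b0 e.
have -> : v = a * p / b * v * (b / (a * p)) by field; rewrite a0 b0 p0.
by rewrite -e; field; rewrite a0 b0 p0.
Qed.

Lemma gbinom_shiftE (R : realType) (p : R) (n : nat) : 1 <= p ->
  gbinom (n%:R * p + (p - 1)) n = gbinom (n.+1%:R * p + 0) n.+1 / p.
Proof.
move=> p1; have p0 : p != 0 by rewrite gt_eqF// (lt_le_trans ltr01).
have n0 : n.+1%:R != 0 :> R by rewrite pnatr_eq0.
rewrite addr0 gbinomS.
have -> : n.+1%:R * p - 1 = n%:R * p + (p - 1) by rewrite -natr1; ring.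
by move: (n.+1%:R : R) n0 => a a0; field; rewrite a0 p0.
Qed.

(** n^n/n! is a single term of the exponential series of e^n. *)
Lemma expn_le_fact_expR (R : realType) (n : nat) :
  n%:R ^+ n <= n`!%:R * expR 1 ^+ n :> R.
Proof.
case: n => [|n]; first by rewrite !expr0 fact0 mulr1.
have := @expR_ge1Dxn R n.+1%:R n (ler0n _ _).
rewrite -[in expR _](mulr1 n.+1%:R) expRM_natl => h.
by rewrite mulrC -ler_pdivrMr ?ltr0n ?fact_gt0//; lra.
Qed.

(** For n >= 1 each factor np + r - i lies in [0, 2pn]; the lower end uses i <= n-1 and r >= -1.
    What remains is (2pn)^n/n! <= (2pe)^n. *)
Lemma gbinom_bound (R : realType) (p r : R) (n : nat) :
  1 <= p -> -1 <= r <= p - 1 ->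
  `|gbinom (n%:R * p + r) n| <= (2 * p * expR 1) ^+ n.
Proof.
move=> p1 /andP[r1 rp]; case: n => [|n]; first by rewrite gbinom0 normr1.
have p0 : 0 < p by lra.
rewrite /gbinom normrM normrV ?unitfE ?pnatr_eq0 -?lt0n ?fact_gt0//.
rewrite [`|_`!%:R|]ger0_norm ?ler0n// ler_pdivrMr ?ltr0n ?fact_gt0//.
rewrite normr_prod; apply: (@le_trans _ _ ((2 * p * n.+1%:R) ^+ n.+1)).
  rewrite -[X in _ ^+ X]card_ord -prodr_const; apply: ler_prod => i _.
  rewrite normr_ge0/=.
  have i0 : 0 <= i%:R :> R by [].
  have i1 : i%:R <= n%:R :> R by rewrite ler_nat -ltnS.
  have n0 : 0 <= n%:R :> R by [].
  rewrite -natr1 ger0_norm; nra.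
rewrite exprMn [leRHS]mulrC [in leRHS]exprMn mulrCA.
by apply: ler_wpM2l; [rewrite exprn_ge0//; lra|exact: expn_le_fact_expR].
Qed.

(** * Approximation of a step function on [0,1] *)

Lemma bernoulli_ineq (R : realType) (x : R) (n : nat) :
  -1 <= x -> 1 + n%:R * x <= (1 + x) ^+ n.
Proof.
move=> x1; elim: n => [|n ih]; first by rewrite mul0r addr0 expr0.
have n0 : 0 <= n%:R :> R by [].
rewrite exprSr; apply: (@le_trans _ _ ((1 + n%:R * x) * (1 + x))).
  rewrite -natr1; nra.
by apply: ler_wpM2r => //; lra.
Qed.

(** With s the square root of z, n s^n <= 1 + s + ... + s^(n-1) <= 1/(1-s), hence n z^n <=
    s^n/(1-s). *)
Lemma cvg_natM_expr (R : realType) (z : R) : 0 <= z < 1 ->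
  n%:R * z ^+ n @[n --> \oo] --> 0.
Proof.
move=> /andP[z0 z1]; pose s := Num.sqrt z.
have s0 : 0 <= s by exact: sqrtr_ge0.
have s1 : s < 1 by rewrite -sqrtr1 ltr_sqrt.
have ss : s ^+ 2 = z by rewrite sqr_sqrtr.
have ns n : n%:R * s ^+ n * (1 - s) <= 1.
  have -> : n%:R * s ^+ n * (1 - s) = (\sum_(i < n) s ^+ n) * (1 - s).
    by rewrite sumr_const card_ord mulr_natl.
  apply: (@le_trans _ _ ((\sum_(i < n) s ^+ i) * (1 - s))).
    apply: ler_wpM2r; first lra.
    apply: ler_sum => i _; apply: ler_wiXn2l => //; [exact: ltW|exact: ltnW].
  have := subrX1 s n; rewrite mulrC => h.
  have sn : 0 <= s ^+ n by exact: exprn_ge0.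
  have -> : (1 - s) = - (s - 1) by ring.
  by rewrite mulrN -h; lra.
apply: (@squeeze_cvgr _ _ _ _ (cst 0) (fun n => (1 - s)^-1 * s ^+ n)).
- apply: nearW => n; rewrite mulr_ge0 ?exprn_ge0//=.
  rewrite -ss -exprM mul2n -addnn exprD mulrA.
  apply: ler_wpM2r; first exact: exprn_ge0.
  by rewrite -[_^-1]mul1r ler_pdivlMr ?ns//; lra.
- exact: cvg_cst.
- rewrite -[X in _ --> X](mulr0 (1 - s)^-1); apply: cvgM; first exact: cvg_cst.
  by apply: cvg_expr; rewrite ger0_norm.
Qed.

(* Bernoulli's inequality gives [1 - n (2y)^n <= (1 - y^n)^(n 2^n)] and
   [(1 - y^n)^(n 2^n) (1 + n (2y)^n) <= 1]; the extra factor [n] in the exponent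
   makes the limit [0] at the threshold [y = 1/2] itself. *)
Lemma cvg_step (R : realType) (y : R) : 0 <= y <= 1 ->
  (1 - y ^+ n) ^+ (n * 2 ^ n) @[n --> \oo] --> ((y < 1 / 2)%R%:R : R).
Proof.
move=> /andP[y0 y1].
have yn0 n : 0 <= y ^+ n by exact: exprn_ge0.
have yn1 n : y ^+ n <= 1 by exact: exprn_ile1.
case: ltP => y2.
  apply: (@squeeze_cvgr _ _ _ _ (fun n => 1 - n%:R * (2 * y) ^+ n) (cst 1)).
  - apply: nearW => n; apply/andP; split; last first.
      by apply: exprn_ile1; have := yn0 n; have := yn1 n; lra.
    have := @bernoulli_ineq R (- y ^+ n) (n * 2 ^ n).
    rewrite lerN2 yn1 => /(_ isT); apply: le_trans.
    by rewrite natrM natrX exprMn mulrN mulrA.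
  - rewrite -[X in _ --> X]subr0; apply: cvgB; first exact: cvg_cst.
    by apply: cvg_natM_expr; apply/andP; split; lra.
  - exact: cvg_cst.
apply: (@squeeze_cvgr _ _ _ _ (cst 0) (@harmonic R)).
- apply: nearW => n; rewrite exprn_ge0 ?subr_ge0//= /harmonic/=.
  rewrite -[leRHS]mul1r ler_pdivlMr ?ltr0n//.
  have h1 : n.+1%:R <= (1 + y ^+ n) ^+ (n * 2 ^ n).
    apply: le_trans (bernoulli_ineq _ _ _ _); last by have := yn0 n; lra.
    rewrite -natr1 addrC lerD2l natrM -mulrA ler_peMr// natrX -exprMn.
    by rewrite exprn_ege1//; lra.
  apply: le_trans (ler_wpM2l _ h1) _; first by rewrite exprn_ge0 ?subr_ge0.
  rewrite -exprMn exprn_ile1//; have := yn0 n; have := yn1 n; nra.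
- exact: cvg_cst.
- exact: cvg_harmonic.
Qed.

(** * From moments to the mass of rays *)

(** The weight may change sign: [w] = x/p has to be treated before [nu_0] is known not to charge the
    negative half-line. *)
Definition weighted_moments (R : realType)
    (mu : {measure set (measurableTypeR R) -> \bar R}) (w : R -> R)
    (m : nat -> R) : Prop :=
  forall n : nat,
    mu.-integrable setT (fun x : measurableTypeR R => ((x : R) ^+ n * w x)%:E) /\
    (\int[mu]_x ((x : R) ^+ n * w x)%:E = (m n)%:E)%E.

Lemma integral_horner (R : realType)
    (mu : {measure set (measurableTypeR R) -> \bar R}) (w : R -> R)
    (m : nat -> R) (P : {poly R}) : weighted_moments R mu w m ->
  (\int[mu]_x (P.[x] * w x)%:E = (\sum_(i < size P) P`_i * m i)%:E)%E.
Proof.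
move=> wm; rewrite -sumEFin.
under eq_integral do rewrite horner_coef mulr_suml -sumEFin.
rewrite integral_sum//; last first.
  move=> i; under eq_fun do rewrite -mulrA EFinM.
  by apply: integrableZl => //; exact: (wm i).1.
apply: eq_bigr => i _; under eq_integral do rewrite -mulrA EFinM.
by rewrite integralZl//; [rewrite (wm i).2|exact: (wm i).1].
Qed.

(* Markov's inequality for [x^(2n)]: the mass of [|x| > 2C] is at most [4^-n]. *)
Lemma ae_bounded_of_moments (R : realType)
    (mu : {measure set (measurableTypeR R) -> \bar R}) (m : nat -> R) (C : R) :
  0 < C -> weighted_moments R mu (cst 1) m -> (forall n, m n <= C ^+ n) ->
  \forall x \ae mu, `|(x : R)| <= 2 * C.
Proof.
move=> C0 mom mC; pose A := [set x : measurableTypeR R | 2 * C < `|(x : R)|].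
have mA : measurable A.
  have := @normr_measurable R setT measurableT `]2 * C, +oo[%classic.
  rewrite setTI => /(_ (measurable_itv _)); congr measurable.
  by apply/seteqP; split => x /=; rewrite in_itv/= andbT.
have A0 : mu A = 0%E.
  apply/eqP; rewrite eq_le measure_ge0 andbT.
  have bnd n : (mu A <= ((1 / 4) ^+ n)%:E)%E.
    have C2 : 0 < (2 * C) ^+ (2 * n) by apply: exprn_gt0; lra.
    have /integrableP[mx _] := (mom (2 * n)%N).1.
    have := le_integral_abse mu measurableT mx C2.
    rewrite setTI.
    have -> : (\int[mu]_x `|((x : R) ^+ (2 * n) * 1)%:E| = (m (2 * n)%N)%:E)%E.
      rewrite -(mom (2 * n)%N).2; apply: eq_integral => x _ /=.
      by rewrite ger0_norm// mulr1 exprM exprn_ge0// sqr_ge0.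
    move=> h; rewrite -(@lee_pmul2l _ ((2 * C) ^+ (2 * n))%:E)//.
    have hA : (mu A <= mu [set x | (((2 * C) ^+ (2 * n))%:E <=
        `|((x : R) ^+ (2 * n) * 1)%:E|)%E])%E.
      apply: le_measure; rewrite ?inE//.
        rewrite -[X in measurable X]setTI; apply: emeasurable_fun_c_infty => //.
        exact: measurableT_comp.
      move=> x; rewrite /A/= mulr1 lee_fin normrX => Ax.
      by apply: lerXn2r; rewrite ?nnegrE//; [lra|exact: ltW].
    apply: (le_trans (lee_wpmul2l _ hA)); first by rewrite lee_fin ltW.
    apply: (le_trans h); rewrite lee_fin; apply: (le_trans (mC _)).
    rewrite (exprM (2 * C)) (exprM C) -exprMn.
    have -> : (2 * C) ^+ 2 * (1 / 4) = C ^+ 2 by field.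
    by [].
  have c1 : (mu A : \bar R) @[n --> \oo] --> mu A by exact: cvg_cst.
  have c2 : ((1 / 4 : R) ^+ n)%:E @[n --> \oo] --> 0%E.
    apply: cvg_EFin; first exact: nearW.
    by apply: cvg_expr; rewrite ger0_norm; lra.
  by apply: (lee_cvg_to c1 c2); exact: nearW.
exists A; split => // x /=; rewrite /A/= => /negP; rewrite -ltNge//.
Qed.

(* The polynomial of [cvg_step] after the affine change of variable sending
   [a - K, a, a + K] to [0, 1/2, 1]. *)
Definition cutp (R : realType) (K a : R) (n : nat) : {poly R} :=
  (1 - ((2 * K)^-1 *: ('X - a%:P) + (1 / 2)%:P) ^+ n) ^+ (n * 2 ^ n).

Lemma cutp_horner (R : realType) (K a x : R) (n : nat) :
  (cutp R K a n).[x] = (1 - ((2 * K)^-1 * (x - a) + 1 / 2) ^+ n) ^+ (n * 2 ^ n).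
Proof. by rewrite /cutp !hornerE. Qed.

Lemma cutp_rescale (R : realType) (K a x : R) : 0 < K -> `|x - a| <= K ->
  0 <= (2 * K)^-1 * (x - a) + 1 / 2 <= 1.
Proof.
move=> K0; rewrite ler_norml => /andP[h1 h2].
have K2 : 0 < 2 * K by lra.
have -> : (2 * K)^-1 * (x - a) + 1 / 2 = (x - a + K) / (2 * K).
  by field; rewrite gt_eqF.
by rewrite divr_ge0 ?ler_pdivrMr//=; lra.
Qed.

Lemma cvg_cutp (R : realType) (K a x : R) : 0 < K -> `|x - a| <= K ->
  (cutp R K a n).[x] @[n --> \oo] --> ((x < a)%R%:R : R).
Proof.
move=> K0 xK; under eq_fun do rewrite cutp_horner.
have -> : (x < a)%R = ((2 * K)^-1 * (x - a) + 1 / 2 < 1 / 2)%R.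
  by rewrite gtrDr pmulr_rlt0 ?subr_lt0// invr_gt0; lra.
by apply: cvg_step; exact: cutp_rescale.
Qed.

Lemma cutp_le1 (R : realType) (K a x : R) (n : nat) : 0 < K -> `|x - a| <= K ->
  `|(cutp R K a n).[x]| <= 1.
Proof.
move=> K0 xK; rewrite cutp_horner normrX.
have /andP[y0 y1] := cutp_rescale R K a x K0 xK.
apply: exprn_ile1 => //; set y := _ + _ in y0 y1 *.
have yn0 : 0 <= y ^+ n by exact: exprn_ge0.
have yn1 : y ^+ n <= 1 by exact: exprn_ile1.
by rewrite ger0_norm; lra.
Qed.

(** The sums on the left see the measure and the weight only through [m], so equal moments and a
    common [K] force equal ray masses. Dominated convergence applies with bound |w|, integrable by
    the case n = 0 of the moment hypothesis. *)
Lemma cvg_cutp_moments (R : realType)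
    (mu : {measure set (measurableTypeR R) -> \bar R}) (w : R -> R)
    (m : nat -> R) (K a : R) :
  0 < K -> weighted_moments R mu w m ->
  (\forall x \ae mu, `|(x : R) - a| <= K) ->
  (\sum_(i < size (cutp R K a n)) (cutp R K a n)`_i * m i)%:E @[n --> \oo] -->
    (\int[mu]_(x in `]-oo, a[) (w x)%:E)%E.
Proof.
move=> K0 mom xK.
have iw : mu.-integrable setT (fun x : measurableTypeR R => (w x)%:E).
  by have := (mom 0%N).1; under eq_fun do rewrite expr0 mul1r.
have mw : measurable_fun setT (fun x : measurableTypeR R => w x).
  by apply/measurable_EFinP; exact: measurable_int iw.
have mI : measurable (`]-oo, a[ : set (measurableTypeR R)) by [].
rewrite integral_mkcond; under eq_fun do rewrite -(integral_horner R mu w)//.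
have [] // := @dominated_convergence _ (measurableTypeR R) R mu setT measurableT
  (fun n x => ((cutp R K a n).[x] * w x)%:E)
  ((fun x : measurableTypeR R => (w x)%:E) \_ `]-oo, a[)
  (fun x => `|(w x)%:E|%E).
- move=> n; apply/measurable_EFinP; apply: measurable_funM => //.
  exact: measurable_poly.
- apply/measurable_restrict => //; apply: measurable_funS (measurable_int _ iw) => //.
- case: xK => N [mN N0 sN]; exists N; split => //.
  apply: subset_trans sN; apply: subsetC => x xK _; rewrite epatch_indic/= indicE.
  rewrite -EFinM; apply: cvg_EFin; first exact: nearW.
  rewrite mulrC mem_setE in_itv/=.
  by apply: cvgM; [exact: cvg_cutp|exact: cvg_cst].
- exact: integrable_abse iw.
- case: xK => N [mN N0 sN]; exists N; split => //.
  apply: subset_trans sN; apply: subsetC => x xK n _; rewrite lee_fin normrM.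
  by rewrite ler_piMl// cutp_le1.
Qed.

(** * Equality of measures and measures with a density *)

(** Open left rays are stable under intersection and generate the Borel sets, and the rays ending at
    natural numbers exhaust the line with finite mass. *)
Lemma measure_eq_of_rays (R : realType)
    (m1 m2 : {measure set (measurableTypeR R) -> \bar R}) :
  (forall a : R, (m1 `]-oo, a[%classic < +oo)%E) ->
  (forall a : R, m1 `]-oo, a[%classic = m2 `]-oo, a[%classic) ->
  forall A, measurable A -> m1 A = m2 A.
Proof.
move=> m1oo m12; have mE : @measurable _ (measurableTypeR R) = <<s RGenInftyO.G (R := R) >>.
  exact: RGenInftyO.measurableE.
have GI : setI_closed (RGenInftyO.G (R := R)).
  move=> _ _ [x ->] [y ->]; exists (Num.min x y).
  apply/seteqP; split => z /=; rewrite !in_itv/= lt_min.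
    by case=> -> ->.
  by move/andP.
apply: (@measure_unique _ R (measurableTypeR R) (RGenInftyO.G (R := R))
  (fun k => `]-oo, k%:R[%classic) mE GI).
- by move=> i; exists i%:R.
- apply/seteqP; split => // x _; exists (Num.truncn `|x|).+1 => //=.
  by rewrite in_itv/= (le_lt_trans (ler_norm x))// truncnS_gt.
- by move=> _ [x ->].
- by [].
Qed.

(** The proofs [mf] and [f0] are arguments so that the measure structure can be attached to the term
    itself. *)
Definition nn_density d (T : measurableType d) (R : realType)
    (mu : {measure set T -> \bar R}) (f : T -> \bar R)
    (mf : measurable_fun setT f) (f0 : forall x, (0 <= f x)%E) :
  set T -> \bar R := fun A => (\int[mu]_(x in A) f x)%E.

Section nn_density.
Context d (T : measurableType d) (R : realType).
Variables (mu : {measure set T -> \bar R}) (f : T -> \bar R).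
Hypotheses (mf : measurable_fun setT f) (f0 : forall x, (0 <= f x)%E).

Let density0 : nn_density d T R mu f mf f0 set0 = 0%E.
Proof. exact: integral_set0. Qed.

Let density_ge0 A : (0 <= nn_density d T R mu f mf f0 A)%E.
Proof. by apply: integral_ge0. Qed.

Let density_sigma_additive : semi_sigma_additive (nn_density d T R mu f mf f0).
Proof. exact: semi_sigma_additive_nng_induced. Qed.

HB.instance Definition _ := isMeasure.Build d T R (nn_density d T R mu f mf f0)
  density0 density_ge0 density_sigma_additive.

End nn_density.

(** * Application to the measures nu(p,r) *)

Lemma is_nu_moments (R : realType) (p r : R)
    (mu : probability (measurableTypeR R) R) : is_nu p r mu ->
  weighted_moments R mu (cst 1) (fun n => gbinom (n%:R * p + r) n).
Proof. by move=> h n; have := h n; under eq_fun do rewrite -[_ ^+ n]mulr1. Qed.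

(** The bound does not depend on [r], so one sequence of cut-off polynomials serves all three
    measures. *)
Lemma ae_is_nu_bounded (R : realType) (p r a : R)
    (mu : probability (measurableTypeR R) R) :
  1 <= p -> -1 <= r <= p - 1 -> is_nu p r mu ->
  \forall x \ae mu, `|(x : R) - a| <= 2 * (2 * p * expR 1) + `|a|.
Proof.
move=> p1 rp /is_nu_moments h.
have C0 : 0 < 2 * p * expR 1 by rewrite mulr_gt0 ?expR_gt0//; lra.
have [|N [mN N0 sN]] := ae_bounded_of_moments R mu _ _ C0 h.
  by move=> n; apply: le_trans (ler_norm _) _; exact: gbinom_bound.
exists N; split => //; apply: subset_trans sN; apply: subsetC => x /= xC.
by apply: le_trans (ler_normB _ _) _; rewrite lerD2r.
Qed.

Lemma cvg_is_nu_ray (R : realType) (p r a : R)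
    (mu : probability (measurableTypeR R) R) :
  1 <= p -> -1 <= r <= p - 1 -> is_nu p r mu ->
  let q n := cutp R (2 * (2 * p * expR 1) + `|a|) a n in
  (\sum_(i < size (q n)) (q n)`_i * gbinom (i%:R * p + r) i)%:E @[n --> \oo] -->
    mu `]-oo, a[%classic.
Proof.
move=> p1 rp h q; have -> : mu `]-oo, a[%classic =
    (\int[mu]_(x in `]-oo, a[) (cst 1 x)%:E)%E.
  by rewrite (integral_cst mu _ 1%E)// mul1e.
apply: (cvg_cutp_moments R mu (cst 1) (fun n => gbinom (n%:R * p + r) n)).
- by rewrite ltr_pwDl// !mulr_gt0 ?expR_gt0//; lra.
- exact: is_nu_moments.
- exact: (ae_is_nu_bounded R p r a mu).
Qed.

Theorem proposition3p5 (R : realType) (p : R) (hp : 1 <= p)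
    (nu_m1 nu_0 nu_p1 : probability (measurableTypeR R) R)
    (h_m1 : is_nu p (-1) nu_m1)
    (h_0 : is_nu p 0 nu_0)
    (h_p1 : is_nu p (p - 1) nu_p1) :
  (forall A : set (measurableTypeR R), measurable A ->
    (nu_m1 A = (1 / p)%:E * \d_(0%R : R) A + ((p - 1) / p)%:E * nu_0 A)%E) /\
  (forall A : set (measurableTypeR R), measurable A ->
    (nu_p1 A = \int[nu_0]_(x in A) ((x : R) / p)%:E)%E).
Proof.
have p0 : 0 < p by lra.
have K0 (a : R) : 0 < 2 * (2 * p * expR 1) + `|a|.
  by rewrite ltr_pwDl// !mulr_gt0 ?expR_gt0//; lra.
have r0 : -1 <= (0 : R) <= p - 1 by lra.
have rm : -1 <= (-1 : R) <= p - 1 by lra.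
have rp : -1 <= p - 1 <= p - 1 by lra.
have prob_lty (mu : probability (measurableTypeR R) R) (a : R) :
    (mu `]-oo, a[%classic < +oo)%E.
  by rewrite (le_lt_trans (probability_le1 _ _))// ltry.
split.
- have c1 : 0 <= 1 / p by rewrite divr_ge0//; lra.
  have c2 : 0 <= (p - 1) / p by rewrite divr_ge0//; lra.
  pose m2 := measure_add (mscale (NngNum c1) (\d_(0 : measurableTypeR R)))
                         (mscale (NngNum c2) nu_0).
  have m2E A : m2 A = ((1 / p)%:E * \d_(0%R : R) A + ((p - 1) / p)%:E * nu_0 A)%E.
    exact: measure_addE.
  move=> A mA; rewrite -m2E; move: A mA.
  apply: measure_eq_of_rays; first exact: prob_lty.
  move=> a; have := cvg_is_nu_ray _ _ _ a _ hp rm h_m1.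
  set q := cutp _ _ _ => /= h1.
  suff h2 : (\sum_(i < size (q n)) (q n)`_i * gbinom (i%:R * p + -1) i)%:E
      @[n --> \oo] --> m2 `]-oo, a[%classic.
    exact: (cvg_unique (@ereal_hausdorff R) h1 h2).
  rewrite m2E; under eq_fun => n.
    (* The moments 0^i of the point mass sum, against the coefficients of [q n], to its value at
       0. *)
    rewrite (_ : \sum_(i < _) _ = 1 / p * (q n).[0] + (p - 1) / p *
      \sum_(i < size (q n)) (q n)`_i * gbinom (i%:R * p + 0) i); last first.
      rewrite horner_coef !mulr_sumr -big_split/=; apply: eq_bigr => i _.
      by rewrite gbinom_predE//; ring.
    rewrite EFinD !EFinM.
    over.
  apply: cvgeD; first by rewrite fin_num_adde_defr// fin_numM// dirac_fin_num.
  (* The values at 0 tend to the indicator of 0 < a, the Dirac mass of the ray; the summand |a| in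
     the half-width keeps 0 within range. *)
  + apply: cvgeZl => //; rewrite diracE mem_setE in_itv/=.
    apply: cvg_EFin; first exact: nearW.
    apply: cvg_cutp => //; rewrite sub0r normrN lerDr.
    by rewrite !mulr_ge0 ?expR_ge0//; lra.
  + by apply: cvgeZl => //; exact: cvg_is_nu_ray.
(* Weighting by x/p turns the n-th moment into the (n+1)-st divided by p. *)
- have wm : weighted_moments R nu_0 (fun x => x / p)
      (fun n => gbinom (n%:R * p + (p - 1)) n).
    move=> n; have [i0 m0] := h_0 n.+1.
    have -> : (fun x : measurableTypeR R => ((x : R) ^+ n * (x / p))%:E) =
        (fun x : measurableTypeR R => p^-1%:E * ((x : R) ^+ n.+1)%:E)%E.
      by apply/funext => x; rewrite -EFinM mulrA -exprSr mulrC.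
    split; first exact: integrableZl.
    by rewrite integralZl// m0 -EFinM gbinom_shiftE// mulrC.
  have ray a : nu_p1 `]-oo, a[%classic =
      (\int[nu_0]_(x in `]-oo, a[) ((x : R) / p)%:E)%E.
    have h1 := cvg_is_nu_ray _ _ _ a _ hp rp h_p1.
    have h2 := cvg_cutp_moments _ _ _ _ _ a (K0 a) wm
      (ae_is_nu_bounded _ _ _ a _ hp r0 h_0).
    exact: (cvg_unique (@ereal_hausdorff R) h1 h2).
  have mid : measurable_fun setT (fun x : measurableTypeR R => ((x : R) / p)%:E).
    by apply/measurable_EFinP; apply: measurable_funM.
  (* Truncating at 0 gives a density that is nonnegative everywhere; it is compared with x/p only
     almost everywhere. *)
  pose f (x : measurableTypeR R) : \bar R := maxe ((x : R) / p)%:E 0%E.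
  have f0 x : (0 <= f x)%E by rewrite le_max lexx orbT.
  have mf : measurable_fun setT f by exact: measurable_maxe.
  (* On the negative ray the integral of |x/p| equals minus the mass under [nu_p1], hence is at most
     0, so x/p vanishes almost everywhere there. *)
  have neg0 : {ae nu_0, forall x : measurableTypeR R,
      `]-oo, 0%R[%classic x -> ((x : R) / p)%:E = 0%E}.
    have mneg : measurable (`]-oo, (0 : R)[%classic : set (measurableTypeR R)) by [].
    apply/(ae_eq_integral_abs nu_0 mneg (measurable_funTS mid)).
    apply/eqP; rewrite eq_le integral_ge0// andbT.
    rewrite -oppe_ge0 -integral_ge0N//.
    have <- : (nu_p1 `]-oo, 0%R[%classic =
        \int[nu_0]_(x in `]-oo, 0%R[) - `|((x : R) / p)%:E|)%E.
      rewrite ray; apply: eq_integral => x; rewrite inE/= in_itv/= => x0.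
      by rewrite ltr0_norm ?opprK// pmulr_llt0 ?invr_gt0.
    exact: measure_ge0.
  have feq : ae_eq nu_0 setT f (fun x => ((x : R) / p)%:E).
    case: neg0 => N [mN N0 sN]; exists N; split => //.
    apply: subset_trans sN; apply: subsetC => x /= xN _; rewrite /f.
    have [x0|x0] := leP 0 x; first by rewrite max_l// lee_fin divr_ge0// ltW.
    by rewrite xN ?maxxx// in_itv.
  move=> A mA; transitivity (nn_density _ _ _ nu_0 f mf f0 A); last first.
    apply: ae_eq_integral => //; [exact: measurable_funTS..|].
    exact: ae_eq_subset feq.
  move: A mA; apply: measure_eq_of_rays; first exact: prob_lty.
  move=> a; apply: (etrans (ray a)); apply: ae_eq_integral => //; [exact: measurable_funTS..|].
  by apply: ae_eq_sym; exact: ae_eq_subset feq.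
Qed.
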